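(* Let $C$ be a Cantor set with a regular ultrametric $d$, let $\mathcal V$ be the vertex set of its Michon tree, and let $\lambda_1>\lambda_2>\cdots$ be the distinct values of $\mathrm{diam}[v]$, $v\in\mathcal V$. For each $n$ let $M_n$ be a positive integer such that every vertex $v$ with $\mathrm{diam}[v]\ge\lambda_n$ has at most $M_n$ children. Let $s_0$ be the abscissa of convergence of $\zeta(s)=\mathrm{Tr}(|D|^{-s})$. If $$\frac{\log M_n}{-\log\lambda_n}\to 0\quad\text{as } n\to\infty,$$ then $s_0=\overline{\dim}_B(C)$.
   Context: A Cantor set is a (nonempty) totally disconnected compact metrizable space without isolated points. A metric $d$ on $C$ is regular if it induces the topology of $C$, and it is an ultrametric if $d(x,y)\le\max\{d(x,z),d(z,y)\}$ for all $x,y,z$. The reduced weighted rooted tree (Michon tree) of $(C,d)$ has vertex set $\mathcal V$ as follows: the vertices correspond to the distinct subsets of $C$ of the form $\{y: d(x,y)<\epsilon\}$ ($x\in C$, $\epsilon>0$); the root is $C$; the children of a vertex are the maximal vertices strictly contained in it. For $v\in\mathcal V$, $[v]\subset C$ denotes the corresponding subset; it is clopen with $\mathrm{diam}[v]>0$, and $\mathcal V$ is countable. On $\mathcal H=\ell^2(\mathcal V)\otimes\mathbb C^2$ the Dirac operator is $(D\psi)(v)=(\mathrm{diam}[v])^{-1}\sigma_1\psi(v)$ with $\sigma_1=\begin{pmatrix}0&1\\1&0\end{pmatrix}$, so that $(|D|^{-1}\psi)(v)=\mathrm{diam}[v]\,\psi(v)$ and $\mathrm{Tr}(|D|^{-s})=2\sum_{v\in\mathcal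 V}(\mathrm{diam}[v])^s$. The abscissa of convergence $s_0$ is the infimum of the real $s$ for which this series converges (possibly $+\infty$). The upper box dimension is $\overline{\dim}_B(C)=\limsup_{\delta\downarrow0}\frac{\log N_\delta(C)}{-\log\delta}$, where $N_\delta(C)$ is the least number of sets of diameter at most $\delta$ that cover $C$. *)

(* Defs.v *)
From HB Require Import structures.
From mathcomp Require Import all_boot all_order all_algebra.
From mathcomp Require Import complex.
From mathcomp Require Import all_classical all_reals all_analysis.

Set Implicit Arguments.
Unset Strict Implicit.
Unset Printing Implicit Defensive.

Import Order.TTheory GRing.Theory Num.Theory.
Import numFieldNormedType.Exports.

Local Open Scope classical_set_scope.
Local Open Scope ring_scope.
Local Open Scope complex_scope.

(* Metrizability is not listed: the definition is used on a metricType, whose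
   topology is by construction the one induced by its distance mdist.  The same
   fact makes mdist a regular metric. *)
Definition cantor_set (C : topologicalType) : Prop :=
  [/\ [set: C] !=set0, totally_disconnected [set: C], compact [set: C] &
      isolated [set: C] = set0].

Definition is_ultrametric (R : realType) (C : metricType R) : Prop :=
  forall x y z : C, mdist x y <= Num.max (mdist x z) (mdist z y).

(* This is the diameter only when A is bounded ([sup] returns 0 otherwise); all
   subsets of a compact C are.  Also diam set0 = 0. *)
Definition diam (R : realType) (C : metricType R) (A : set C) : R :=
  sup [set r | exists2 x, A x & exists2 y, A y & r = mdist x y].

Section michon_tree.
Context {R : realType} (C : metricType R).

(* A vertex v is identified with the subset [v] of C that it represents. *)
Definition michon_vertex : set (set C) :=
  [set v | exists x : C, exists2 e : R, 0 < e & v = [set y | mdist x y < e]].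

Definition michon_children (v : set C) : set (set C) :=
  [set w | [/\ michon_vertex w, w `<` v &
    forall u, michon_vertex u -> u `<` v -> w `<=` u -> u = w]].

End michon_tree.

Section dirac.
Context {R : realType} (C : metricType R).

Notation V := (set_type (@michon_vertex R C)).

(* The elements of l^2(V) (x) C^2 are the square-summable spinors.  The
   operators below act vertex by vertex, so they are written on all spinors. *)
Definition spinor := V -> 'cV[R[i]]_2.

Definition sigma1 : 'M[R[i]]_2 := \matrix_(i, j) (i != j)%:R.

Definition dirac (psi : spinor) : spinor :=
  fun v => ((diam (val v))^-1)%:C *: (sigma1 *m psi v).

(* |D|^{-s}: |D| is the positive diagonal operator with |D|^2 = D^* D = D^2 (see
   abs_dirac_powN1_sqr), hence is multiplication by 1 / diam [v]. *)
Definition abs_dirac_powN (s : R) (psi : spinor) : spinor :=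
  fun v => (diam (val v) `^ s)%:C *: psi v.

Definition spinor_basis (p : V * 'I_2) : spinor :=
  fun w => if w == p.1 then delta_mx p.2 0 else 0.

(* Sum of the diagonal coefficients <e_p, T e_p> in the orthonormal basis
   spinor_basis, in [0, +oo].  Since esum is a supremum of finite partial sums,
   this is the trace for positive operators T only. *)
Definition pos_trace (T : spinor -> spinor) : \bar R :=
  \esum_(p in [set: V * 'I_2])
    (complex.Re (T (spinor_basis p) p.1 p.2 0))%:E.

Definition dirac_zeta (s : R) : \bar R := pos_trace (abs_dirac_powN s).

Definition abscissa_of_convergence : \bar R :=
  ereal_inf [set s%:E | s in [set s : R | (dirac_zeta s < +oo)%E]].

End dirac.

Section box_dimension.
Context {R : realType} (C : metricType R).

Definition covered_by (delta : R) (n : nat) : Prop :=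
  exists F : 'I_n -> set C,
    (forall i, diam (F i) <= delta) /\ [set: C] `<=` \bigcup_i F i.

(* The default 0 is never returned when C is compact and 0 < delta. *)
Definition covering_number (delta : R) : nat :=
  xget 0%N [set n | covered_by delta n /\
                    forall m, covered_by delta m -> (n <= m)%N].

Definition upper_box_dim : \bar R :=
  limf_esup (fun delta : R =>
    (ln (covering_number delta)%:R / - ln delta)%:E) (0 : R)^'+.

End box_dimension.

Section coherence.
Context {R : realType} (C : metricType R).

Lemma diam_ge0 (A : set C) : 0 <= diam A.
Proof.
rewrite /diam; set S := [set r | _].
have [hs|/sup_out ->//] := pselect (has_sup S).
case: (hs) => -[r Sr] ub; apply: (@le_trans _ _ r); last exact: ub_le_sup.
by case: Sr => x _ [y _ ->]; exact: mdist_ge0.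
Qed.

Lemma abs_dirac_powN1_sqr (psi : spinor C) :
  abs_dirac_powN (-1) (abs_dirac_powN (-1) psi) = dirac (dirac psi).
Proof.
apply/funext => v; rewrite /abs_dirac_powN /dirac powR_inv1 ?diam_ge0//.
rewrite -scalemxAr !scalerA mulmxA; congr (_ *: _).
suff -> : sigma1 *m sigma1 = 1%:M :> 'M[R[i]]_2 by rewrite mul1mx.
apply/matrixP => i j; rewrite !mxE big_ord_recl big_ord1 !mxE.
by case: i => [[|[|//]] ?]; case: j => [[|[|//]] ?];
  rewrite /= ?mulr0 ?mul0r ?mulr1 ?addr0 ?add0r.
Qed.

Lemma dirac_zetaE (s : R) :
  (dirac_zeta C s =
   2%:E * \esum_(v in @michon_vertex R C) (diam v `^ s)%:E)%E.
Proof.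
pose V := set_type (@michon_vertex R C).
rewrite /dirac_zeta /pos_trace.
transitivity (\esum_(p in [set: V] `*`` (fun=> [set: 'I_2]))
    (diam (val p.1) `^ s)%:E)%E.
  have -> : [set: V] `*`` (fun=> [set: 'I_2]) = setT.
    by apply/seteqP; split.
  apply: eq_esum => -[v j] _.
  by rewrite /abs_dirac_powN /spinor_basis /= eqxx !mxE !eqxx mulr1.
rewrite -(@esum_esum _ _ _ [set: V] (fun=> [set: 'I_2])
  (fun v _ => (diam (val v) `^ s)%:E)); last first.
  by move=> v j _ _; rewrite lee_fin powR_ge0.
transitivity (\esum_(v in [set: V])
    ((diam (val v) `^ s)%:E + (diam (val v) `^ s)%:E))%E.
  apply: eq_esum => v _; rewrite esum_fset; [|exact: finite_finset|]; last first.
    by move=> j _; rewrite lee_fin powR_ge0.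
  have -> : [set: 'I_2] = [set` 'I_2] by apply/seteqP; split.
  rewrite -(@bigfs _ _ _ _ (index_enum 'I_2)) ?index_enum_uniq//.
    by rewrite big_ord_recl big_ord1.
  by move=> i _; rewrite mem_index_enum.
rewrite esumD; [|by move=> v _; rewrite lee_fin powR_ge0..].
rewrite -mule2n mule_natl; congr (_ *+ 2)%E.
rewrite (@reindex_esum _ V (set C) setT _ val)//; split => //.
- by move=> v _; exact: set_valP.
- by move=> v Vv; exists (SigSub (mem_set Vv)).
Qed.

End coherence.

(* Main.v *)
Require Import Defs.
From HB Require Import structures.
From mathcomp Require Import all_boot all_order all_algebra.
From mathcomp Require Import finmap ring lra.
From mathcomp Require Import all_classical all_reals all_analysis.

Set Implicit Arguments.
Unset Strict Implicit.
Unset Printing Implicit Defensive.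

Import Order.TTheory GRing.Theory Num.Theory.
Import numFieldNormedType.Exports.

Local Open Scope classical_set_scope.
Local Open Scope ring_scope.

(** Both numbers measure a growth exponent as [delta] tends to 0: the box
dimension that of the covering number N(delta), the abscissa that of the number
of vertices of diameter greater than [delta].  In an ultrametric space N(delta)
counts the leaves of the tree obtained by cutting the Michon tree at scale
[delta], and the second number counts its inner nodes.  An inner node has at
least two children, so there are fewer inner nodes than leaves
([card_michon_vertex_le]).  Conversely the leaves are children of
inner nodes, so N(delta) is at most [M n] times the number of inner nodes, where
[lambda n] is the last diameter above [delta] ([covered_by_children]).  The
growth hypothesis says that the factor [M n] grows more slowly than every power
of 1/[delta], hence does not change the exponent.

For [abscissa <= dimension], if N(delta) is at most a constant times
[delta `^ (- a)] then so is the number of vertices of diameter greater than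
[delta], and the vertices whose diameter lies between two consecutive powers of
1/2 contribute a geometric series to the zeta function at each [t > a]
([esum_powR_lty]).

For [dimension <= abscissa], if the zeta function is finite at [s] then the
number of vertices of diameter at least [lambda n] is at most
[Z * lambda n `^ (- s)] for a constant [Z].  Multiplying by [M n] and taking
logarithms gives
[ln N(delta) <= ln Z - s * ln (lambda n) + ln (M n)]
([ln_covering_number_le]), and after division by [- ln delta] the terms other
than the middle one vanish in the limit. *)

(** * Compact ultrametric spaces and their balls *)

Section compact_ultrametric.
Context {R : realType} {C : metricType R}.
Context (C_compact : compact [set: C]).
Context (C_ultra : is_ultrametric C).
Implicit Types (x y z p q : C) (v w A : set C) (r e delta : R).

Lemma mdist_isosceles x y z : mdist x y < mdist y z -> mdist x z = mdist y z.
Proof.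
move=> lt_xy; apply/eqP; rewrite eq_le; apply/andP; split.
  by apply: (le_trans (C_ultra x z y)); rewrite ge_max lexx (ltW lt_xy).
have := C_ultra y z x; rewrite (metric_sym y x) le_max.
by case/orP => //; rewrite leNgt lt_xy.
Qed.

Lemma finite_net e : 0 < e ->
  exists s : seq C, forall x, exists2 p, p \in s & mdist p x < e.
Proof.
move=> e_gt0; have [[x0 _]|C0] := pselect ([set: C] !=set0); last first.
  by exists [::] => x; case: C0; exists x.
(* Extraction of finite covers is stated for pointed spaces. *)
pose C' : ptopologicalType := HB.pack (C : Type) (isPointed.Build C x0) C.
have : cover_compact [set: C] by rewrite -(@compact_cover C').
move=> /(_ C setT (fun p => [set x | mdist p x < e])) [].
- move=> p _; rewrite openE => x /= px; apply/nbhs_ballP; exists e => //= y.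
  rewrite ballEmdist/= => xy; rewrite (le_lt_trans (C_ultra p y x))//.
  by rewrite gt_max px.
- by move=> x _; exists x => //=; rewrite mdistxx.
move=> D _ cov; exists (finmap.enum_fset D) => x.
by have [p Dp px] := cov x I; exists p.
Qed.

(** The distances from [p] that are at least [r] are already attained on a
finite [r]-net, because a point and its neighbour in the net are at the same
distance from [p].  So the distances from [p] can accumulate only at 0, which
makes the infima and suprema of distances below attained. *)
Lemma finite_mdist p r : 0 < r -> exists s : seq C, forall y,
  r <= mdist p y -> exists2 q, q \in s & mdist p q = mdist p y.
Proof.
move=> /finite_net [s net]; exists s => y r_py.
have [q qs qy] := net y; exists q => //.
rewrite metric_sym (metric_sym p y); apply: (@mdist_isosceles q y p).
by rewrite (metric_sym y p) (lt_le_trans qy).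
Qed.

Lemma mdist_bounded : exists K, forall x y, mdist x y <= K.
Proof.
have [[x0 _]|C0] := pselect ([set: C] !=set0); last first.
  by exists 0 => x; case: C0; exists x.
have [s hs] := finite_mdist x0 ltr01.
pose K := \big[Num.max/1]_(q <- s) mdist x0 q.
have x0K y : mdist x0 y <= K.
  have [y1|/ltW /hs [q qs <-]] := leP (mdist x0 y) 1.
    exact: (le_trans y1 (bigmax_ge_id _ _ _ _)).
  exact: le_bigmax_seq.
exists K => x y; apply: (le_trans (C_ultra x y x0)).
by rewrite ge_max x0K metric_sym x0K.
Qed.

Lemma mdist_le_diam A x y : A x -> A y -> mdist x y <= diam A.
Proof.
move=> Ax Ay; have [K hK] := mdist_bounded.
apply: ub_le_sup; last by exists x => //; exists y.
by exists K => _ [a _ [b _ ->]].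
Qed.

Lemma diam_le A r : 0 <= r ->
  (forall x y, A x -> A y -> mdist x y <= r) -> diam A <= r.
Proof.
move=> r_ge0 Ar; rewrite /diam; set S := [set _ | _].
have [S0|/nonemptyPn ->] := pselect (S !=set0); last by rewrite sup0.
by apply: ge_sup => // _ [x Ax [y Ay ->]]; exact: Ar.
Qed.

Lemma lt_diam A r : 0 <= r -> r < diam A ->
  exists x y, [/\ A x, A y & r < mdist x y].
Proof.
move=> r_ge0; rewrite ltNge => /negP nle.
apply: contrapT => nex; apply: nle; apply: diam_le => // x y Ax Ay.
by rewrite leNgt; apply/negP => ?; apply: nex; exists x, y.
Qed.

Lemma michon_vertex_recenter v p : michon_vertex v -> v p ->
  exists2 e, 0 < e & v = [set y | mdist p y < e].
Proof.
move=> [x [e e_gt0 ->]]/= xp; exists e => //.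
apply/seteqP; split => y /= ?.
  by rewrite (le_lt_trans (C_ultra p y x))// gt_max metric_sym xp.
by rewrite (le_lt_trans (C_ultra x y p))// gt_max xp.
Qed.

(** The distances from [x] that exceed [r] stay away from [r], so a slightly
larger open ball is the same set. *)
Lemma michon_vertex_cball x r : 0 < r -> michon_vertex [set y | mdist x y <= r].
Proof.
move=> r_gt0; have [s hs] := finite_mdist x r_gt0.
pose e := \big[Num.min/(r + 1)]_(q <- s | r < mdist x q) mdist x q.
have r_e : r < e.
  apply: (big_ind (fun t => r < t)) => [|a b ra rb|//]; first by rewrite ltrDl.
  by rewrite lt_min ra.
exists x; exists e; first exact: lt_trans r_e.
apply/seteqP; split => y /=; first by move=> /le_lt_trans; apply.
move=> ye; rewrite leNgt; apply/negP => ry.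
have [q qs xq] := hs y (ltW ry).
by move: ye; rewrite ltNge -xq ge_bigmin_seq// xq.
Qed.

(** If no distance from [p] were equal to the diameter, the largest of the
finitely many distances from [p] above half the diameter would bound all the
distances in [v], by the ultrametric inequality. *)
Lemma michon_vertex_diam v p : michon_vertex v -> v p -> 0 < diam v ->
  exists2 q, v q & mdist p q = diam v.
Proof.
move=> vv vp D_gt0; set D := diam v in D_gt0 *; apply: contrapT => nex.
have pyD y : v y -> mdist p y < D.
  move=> vy; rewrite lt_neqAle mdist_le_diam// andbT.
  by apply/eqP => ?; apply: nex; exists y.
have D2 : 0 < D / 2 by rewrite divr_gt0.
have [s hs] := finite_mdist p D2.
pose m := \big[Num.max/(D / 2)]_(q <- s | mdist p q < D) mdist p q.
have mD : m < D.
  apply: (big_ind (fun t => t < D)) => [|a b aD bD|//].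
    by rewrite ltr_pdivrMr// ltr_pMr// ltr1n.
  by rewrite gt_max aD.
have m_ge0 : 0 <= m by rewrite (le_trans (ltW D2))// bigmax_ge_id.
have pym y : v y -> mdist p y <= m.
  move=> vy; have [y1|/ltW /hs [q qs pq]] := leP (mdist p y) (D / 2).
    exact: (le_trans y1 (bigmax_ge_id _ _ _ _)).
  by rewrite -pq; apply: le_bigmax_seq => //; rewrite pq pyD.
suff : D <= m by rewrite leNgt mD.
apply: diam_le => // x y vx vy; apply: (le_trans (C_ultra x y p)).
by rewrite ge_max pym// metric_sym pym.
Qed.

Lemma michon_vertex_eq_cball v p : michon_vertex v -> v p -> 0 < diam v ->
  v = [set y | mdist p y <= diam v].
Proof.
move=> vv vp D_gt0; have [q vq pq] := michon_vertex_diam vv vp D_gt0.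
apply/seteqP; split => y /=; first exact: mdist_le_diam.
have [e _ ve] := michon_vertex_recenter vv vp.
rewrite -pq => py; rewrite ve/=; apply: le_lt_trans py _.
by move: vq; rewrite {1}ve.
Qed.

Lemma diam_cball x y : diam [set z | mdist x z <= mdist x y] = mdist x y.
Proof.
apply/eqP; rewrite eq_le; apply/andP; split.
  apply: diam_le => [|a b /= xa xb]; first exact: mdist_ge0.
  by rewrite (le_trans (C_ultra a b x))// ge_max metric_sym xa.
by apply: mdist_le_diam => /=; rewrite ?mdistxx ?mdist_ge0.
Qed.

(** Coverings by a list shorter than [n] are completed with empty sets, whose
diameter is 0. *)
Lemma covered_by_seq delta n (s : seq (set C)) : 0 <= delta ->
  (size s <= n)%N -> (forall A, A \in s -> diam A <= delta) ->
  (forall x, exists2 A, A \in s & A x) -> Defs.covered_by C delta n.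
Proof.
move=> delta_ge0 sn s_diam s_cov; exists (fun i => nth set0 s i); split.
  move=> i; have [lt|ge] := ltnP i (size s); first by rewrite s_diam ?mem_nth.
  by rewrite nth_default//; apply: diam_le.
move=> x _; have [A As Ax] := s_cov x.
have iA : (index A s < n)%N by rewrite (leq_trans _ sn)// index_mem.
by exists (Ordinal iA) => //=; rewrite nth_index.
Qed.

Lemma ex_covered_by delta : 0 < delta -> exists n, Defs.covered_by C delta n.
Proof.
move=> delta_gt0; have [s hs] := finite_net delta_gt0.
exists (size s).
apply: (@covered_by_seq delta _ [seq [set y | mdist p y < delta] | p <- s]).
- exact: ltW.
- by rewrite size_map.
- move=> _ /mapP [p _ ->]; apply: diam_le => [|a b /= pa pb]; first exact: ltW.
  by rewrite (le_trans (C_ultra a b p))// ge_max metric_sym !ltW.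
- move=> x; have [p ps px] := hs x; exists [set y | mdist p y < delta] => //.
  exact: map_f.
Qed.

Lemma covering_numberP delta : 0 < delta ->
  Defs.covered_by C delta (covering_number C delta) /\
  forall m, Defs.covered_by C delta m -> (covering_number C delta <= m)%N.
Proof.
move=> /ex_covered_by ex; rewrite /covering_number.
set S := [set n | _].
have exb : exists n, `[< Defs.covered_by C delta n >].
  by have [n ?] := ex; exists n; apply/asboolP.
case: (ex_minnP exb) => n /asboolP cn min_n.
have Sn : S n by split => // m /asboolP; exact: min_n.
exact: (xgetI 0%N Sn).
Qed.

Lemma covering_number_gt0 delta : [set: C] !=set0 -> 0 < delta ->
  (0 < covering_number C delta)%N.
Proof.
move=> [x _] /covering_numberP [[F [_ cov]] _].
have [i _ _] := cov x I; exact: leq_ltn_trans (ltn_ord i).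
Qed.

(** A tree has fewer inner nodes than leaves.  Choose a point [p k] in each of
the [n] sets of the covering, and send [k] to the closed ball [g k] around
[p k] whose radius is the distance to the set of the earlier points [p j].  Each
vertex [v] of diameter [D > delta] is reached: if [j] is the first index with
[p j] in [v], and [i] the first index with [p i] at distance [D] from [p j],
then [p i] is at distance at least [D] from all earlier points, since an earlier
point closer to [p i] would also be at distance [D] from [p j]. *)
Lemma card_michon_vertex_le delta n : 0 < delta -> Defs.covered_by C delta n ->
  ([set v | @michon_vertex R C v /\ (delta < diam v)%R] #<= `I_n)%card.
Proof.
move=> delta_gt0 [F [F_diam F_cov]]; set V := [set v | _].
have [[x0 _]|C0] := pselect ([set: C] !=set0); last first.
  suff -> : V = set0 by exact: card_ge0.
  by apply/seteqP; split => // v [[x _] _]; case: C0; exists x.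
pose p k := if insub k is Some i then xget x0 (F i) else x0.
have near_p x : exists2 k, (k < n)%N & mdist (p k) x <= delta.
  have [i _ Fx] := F_cov x I; exists i => //; rewrite /p valK.
  by apply: le_trans (F_diam i); apply: mdist_le_diam => //; exact: xgetI Fx.
pose g k := [set y | forall j, (j < k)%N -> mdist (p k) y <= mdist (p k) (p j)].
suff /subset_card_le/card_le_trans : V `<=` g @` `I_n.
  by apply; exact: card_image_le.
move=> v [vv delta_v]; set D := diam v in delta_v.
have D_gt0 : 0 < D by exact: lt_trans delta_v.
have cballE q : v q -> v = [set y | mdist q y <= D].
  by move=> vq; exact: michon_vertex_eq_cball.
have [x [_ [vx _ _]]] := lt_diam (ltW delta_gt0) delta_v.
have exj : exists k, (k < n)%N && `[< v (p k) >].
  have [k kn kx] := near_p x; exists k; rewrite kn/=; apply/asboolP.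
  by rewrite (cballE x vx)/= metric_sym (le_trans kx)// ltW.
case: (ex_minnP exj) => j /andP[jn /asboolP vj] min_j.
have exi : exists k, (k < n)%N && (mdist (p j) (p k) == D).
  have [q vq jq] := michon_vertex_diam vv vj D_gt0.
  have [k kn kq] := near_p q; exists k; rewrite kn/=; apply/eqP.
  rewrite metric_sym -[RHS]jq (metric_sym _ q); apply: mdist_isosceles.
  by rewrite (metric_sym q) jq (le_lt_trans kq).
case: (ex_minnP exi) => i /andP[i_n /eqP jiD] min_i.
have vi : v (p i) by rewrite (cballE _ vj)/= jiD.
have ji : (j < i)%N.
  rewrite ltn_neqAle min_j ?i_n; last by rewrite andTb; apply/asboolP.
  by rewrite andbT; apply: contraTneq D_gt0 => ji; rewrite -jiD ji mdistxx ltxx.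
exists i => //; rewrite [RHS](cballE _ vi); apply/seteqP; split => y /=.
  by move=> /(_ j ji); rewrite (metric_sym (p i) (p j)) jiD.
move=> iy k ki; apply: (le_trans iy); rewrite leNgt; apply/negP => ikD.
suff : (i <= k)%N by rewrite leqNgt ki.
apply: min_i; rewrite (ltn_trans ki i_n)/=; apply/eqP.
rewrite metric_sym -jiD (metric_sym _ (p i)); apply: mdist_isosceles.
by rewrite (metric_sym (p k)) (metric_sym (p i) (p j)) jiD.
Qed.

End compact_ultrametric.

(** * Diameters of the vertices and children of a vertex *)

Lemma card_fset_set_le (T : choiceType) (A : set T) n :
  (A #<= `I_n)%card -> (#|` fset_set A| <= n)%N.
Proof.
move=> An; have /finite_setP[k Ak] : finite_set A.
  exact: card_le_finite An (finite_II n).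
by rewrite (card_fset_set Ak) -card_le_II -(card_le_eql Ak).
Qed.

Section diameter_spectrum.
Context {R : realType} {C : metricType R}.
Context (C_compact : compact [set: C]).
Context (C_ultra : is_ultrametric C).
Context (lambda : nat -> R).
Context (lambda_decr : forall m n : nat, (m < n)%N -> lambda n < lambda m).
Context (lambda_range : range lambda = [set diam v | v in @michon_vertex R C]).

Lemma lambda_gt0 n : 0 < lambda n.
Proof.
have [v _ vn] : [set diam v | v in @michon_vertex R C] (lambda n.+1).
  by rewrite -lambda_range; exists n.+1.
by rewrite (le_lt_trans (diam_ge0 v))// vn lambda_decr.
Qed.

Lemma lambda_leE m n : (lambda m <= lambda n) = (n <= m)%N.
Proof.
case: leqP => [|mn]; last by apply/negbTE; rewrite -ltNge lambda_decr.
by rewrite leq_eqVlt => /predU1P[->|nm]; rewrite ?lexx// ltW// lambda_decr.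
Qed.

Lemma michon_vertex_lambda v : @michon_vertex R C v ->
  exists n, diam v = lambda n.
Proof.
move=> vv; have : range lambda (diam v) by rewrite lambda_range; exists v.
by move=> [n _ <-]; exists n.
Qed.

(** A distance [mdist x y] is the diameter of the closed ball around [x] with
this radius. *)
Lemma mdist_lambda (x y : C) : 0 < mdist x y -> exists n, mdist x y = lambda n.
Proof.
move=> xy; rewrite -(diam_cball C_compact C_ultra); apply: michon_vertex_lambda.
exact: michon_vertex_cball.
Qed.

Lemma ex_lambda_le r : [set: C] !=set0 -> 0 < r -> exists n, lambda n <= r.
Proof.
move=> [x _] r_gt0.
have [n nE] : exists n, diam [set y | mdist x y < r] = lambda n.
  by apply: michon_vertex_lambda; exists x, r.
exists n; rewrite -nE; apply: diam_le => [|a b /= xa xb]; first exact: ltW.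
by rewrite (le_trans (C_ultra a b x))// ge_max metric_sym !ltW.
Qed.

(** Some vertex contains two points at distance [lambda n], and [x] cannot be
closer than that to both. *)
Lemma mdist_lambda_ge n (x : C) : exists y, lambda n <= mdist x y.
Proof.
have [v vv vn] : [set diam v | v in @michon_vertex R C] (lambda n).
  by rewrite -lambda_range; exists n.
have [p [e e_gt0 ve]] := vv.
have vp : v p by rewrite ve/= mdistxx.
have [|q vq pq] := michon_vertex_diam C_compact C_ultra vv vp.
  by rewrite vn lambda_gt0.
have := C_ultra p q x; rewrite pq vn le_max (metric_sym p).
by case/orP => ?; [exists p|exists q].
Qed.

(** The parent is the closed ball around [x] whose radius is the least distance
from [x] that is at least [lambda n], that is [lambda m] for the largest
admissible [m <= n]: no vertex lies strictly between it and the open ball of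
radius [lambda n]. *)
Lemma michon_children_ball n (x : C) : exists v,
  [/\ michon_vertex v, lambda n <= diam v &
      michon_children v [set y | mdist x y < lambda n]].
Proof.
set w := [set y | _].
have exm : exists m, (m <= n)%N && `[< exists y, mdist x y = lambda m >].
  have [y ny] := mdist_lambda_ge n x.
  have [m xym] := mdist_lambda (lt_le_trans (lambda_gt0 n) ny).
  exists m; rewrite -lambda_leE -xym ny/=; apply/asboolP; exists y.
  by [].
have ubm m : (m <= n)%N && `[< exists y, mdist x y = lambda m >] -> (m <= n)%N.
  by case/andP.
case: (ex_maxnP exm ubm) => m /andP[mn /asboolP[y xy]] max_m.
exists [set z | mdist x z <= mdist x y]; split.
- by apply: michon_vertex_cball => //; rewrite xy lambda_gt0.
- by rewrite diam_cball// xy lambda_leE.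
split.
- by exists x, (lambda n); rewrite // lambda_gt0.
- split; last by move=> /(_ y (lexx _)); rewrite /w/= xy ltNge lambda_leE mn.
  by move=> z /= /ltW /le_trans; apply; rewrite xy lambda_leE.
move=> u uu [uv nvu] wu; apply/seteqP; split => // z uz.
rewrite /w/= ltNge; apply/negP => nz; apply: nvu.
have ux : u x by apply: wu; rewrite /w/= mdistxx lambda_gt0.
have [k xzk] := mdist_lambda (lt_le_trans (lambda_gt0 n) nz).
have km : (k <= m)%N.
  apply: max_m; rewrite -lambda_leE -xzk nz/=; apply/asboolP; exists z.
  by [].
have [e _ ue] := michon_vertex_recenter C_ultra uu ux.
move=> t /= xt; rewrite ue/=; apply: le_lt_trans xt _.
rewrite xy; apply: (@le_lt_trans _ _ (mdist x z)).
  by rewrite xzk lambda_leE.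
by move: uz; rewrite {1}ue.
Qed.

Lemma finite_michon_vertex_ge r : 0 < r ->
  finite_set [set v | @michon_vertex R C v /\ r <= diam v].
Proof.
move=> r_gt0; have r2 : 0 < r / 2 by rewrite divr_gt0.
have [n rn] := ex_covered_by C_compact C_ultra r2.
apply: card_le_finite (finite_II n).
apply: card_le_trans (card_michon_vertex_le C_compact C_ultra r2 rn).
apply: subset_card_le => v [vv rv]; split => //; apply: lt_le_trans rv.
by rewrite ltr_pdivrMr// ltr_pMr// ltr1n.
Qed.

(** The open balls of radius [lambda n] cover the space; they have diameter at
most [lambda n.+1], since no distance lies strictly between these two numbers,
and each of them is a child of a vertex of diameter at least [lambda n]. *)
Lemma covered_by_children n m :
  (forall v, @michon_vertex R C v -> lambda n <= diam v ->
    (michon_children v #<= `I_m)%card) ->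
  Defs.covered_by C (lambda n.+1)
    (#|` fset_set [set v | @michon_vertex R C v /\ lambda n <= diam v]| * m).
Proof.
move=> children_m; set W := [set v | _].
have W_fin : finite_set W := finite_michon_vertex_ge (lambda_gt0 n).
pose small (A : set C) := diam A <= lambda n.+1.
pose S := [seq A <- flatten [seq (enum_fset (fset_set (michon_children v)))
                              | v <- fset_set W] | small A].
apply: (@covered_by_seq _ _ _ _ S).
- exact/ltW/lambda_gt0.
- rewrite size_filter (leq_trans (count_size _ _))// size_flatten.
  rewrite sumnE big_map big_map -sum1_size big_distrl/= big_seq [leqRHS]big_seq.
  apply: leq_sum => v; rewrite in_fset_set// inE => -[vv nv].
  by rewrite mul1n card_fset_set_le// children_m.
- by move=> A; rewrite mem_filter => /andP[].
- move=> x; exists [set y | mdist x y < lambda n]; last first.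
    by rewrite /= mdistxx lambda_gt0.
  have [v [vv nv vx]] := michon_children_ball n x.
  rewrite mem_filter; apply/andP; split; last first.
    apply/flattenP; exists (enum_fset (fset_set (michon_children v))).
      apply: (map_f (fun v => enum_fset (fset_set (michon_children v)))).
      by rewrite in_fset_set// inE.
    rewrite in_fset_set ?inE//.
    exact: card_le_finite (children_m v vv nv) (finite_II m).
  rewrite /small leNgt; apply/negP.
  move=> /(lt_diam (ltW (lambda_gt0 _))) [a [b [/= xa xb nab]]].
  have [k abk] := mdist_lambda (lt_trans (lambda_gt0 _) nab).
  have : mdist a b < lambda n.
    by rewrite (le_lt_trans (C_ultra a b x))// gt_max metric_sym xa.
  rewrite abk ltNge lambda_leE -ltnNge => nk.
  by move: nab; rewrite abk ltNge lambda_leE nk.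
Qed.

End diameter_spectrum.

(** * From counting functions to convergence exponents *)

Lemma powR_exprn (R : realType) (x t : R) k :
  0 <= x -> (x ^+ k) `^ t = (x `^ t) ^+ k.
Proof.
move=> x0; elim: k => [|k IH]; first by rewrite !expr0 powR1.
by rewrite !exprS powRM ?exprn_ge0// IH.
Qed.

Lemma sum_geometric_le (R : realType) (q : R) n : 0 <= q -> q < 1 ->
  \sum_(k < n) q ^+ k <= (1 - q)^-1.
Proof.
move=> q0 q1; rewrite -[leRHS]mulr1 -[leLHS](mulKf (x := 1 - q)); last first.
  by rewrite subr_eq0 gt_eqF.
apply: ler_wpM2l; first by rewrite invr_ge0 subr_ge0 ltW.
by rewrite -opprB mulNr -subrX1 opprB gerBl exprn_ge0.
Qed.

(** If at most [B * delta `^ (- a)] points have [f > delta], the points with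
[L / 2 ^ k.+1 < f <= L / 2 ^ k] contribute at most a constant times
[(2 `^ (a - t)) ^+ k] to the sum of [f `^ t], and this is summable for
[a < t]. *)
Lemma esum_powR_lty (R : realType) (T : choiceType) (A : set T) (f : T -> R)
    (L B a t : R) : 0 < L -> 0 <= a -> a < t ->
    (forall x, A x -> 0 < f x <= L) ->
    (forall delta, 0 < delta <= L -> exists2 n,
      ([set x | A x /\ (delta < f x)%R] #<= `I_n)%card &
      n%:R <= B * delta `^ (- a)) ->
  (\esum_(x in A) (f x `^ t)%:E < +oo)%E.
Proof.
move=> L0 a0 at_ fL count_f.
have t0 : 0 < t by exact: le_lt_trans at_.
pose h : R := 2^-1; pose d k := L * h ^+ k.
have h0 : 0 < h by rewrite invr_gt0.
have h1 : h < 1 by rewrite invf_lt1// ltr1n.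
have d_gt0 k : 0 < d k by rewrite mulr_gt0// exprn_gt0.
have d_le k : d k <= L.
  by rewrite ger_pMr// exprn_ile1// ltW.
pose q := h `^ (t - a).
have q0 : 0 <= q by exact: powR_ge0.
have q1 : q < 1.
  rewrite -(powRr0 h) /q /powR gt_eqF// ltr_expR ltr_nM2r ?subr_gt0//.
  by rewrite ln_lt0 ?h0.
pose c := B * L `^ (t - a) * h `^ (- a).
have dE k u : d k `^ u = L `^ u * (h `^ u) ^+ k.
  by rewrite /d powRM ?exprn_ge0 ?(ltW L0) ?(ltW h0)// powR_exprn// ltW.
have term k : d k `^ t * (B * d k.+1 `^ (- a)) = c * q ^+ k.
  have xD x : 0 < x -> x `^ (t - a) = x `^ t * x `^ (- a).
    by move=> x0; rewrite powRD// (gt_eqF x0) implybT.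
  rewrite /c /q !dE !xD// exprMn exprS.
  ring.
apply: (@le_lt_trans _ _ (c / (1 - q))%:E); last exact: ltry.
apply: ge_ereal_sup => _ [X [X_fin XA] <-].
rewrite fsbig_finite//= sumEFin lee_fin.
have ex_k x : A x -> exists k, d k.+1 < f x <= d k.
  move=> /fL/andP[fx0 fxL].
  have : geometric L h @ \oo --> (0 : R).
    by apply: cvg_geometric; rewrite gtr0_norm.
  move=> /cvgr_lt /(_ (f x) fx0) [N _ /(_ N (leqnn N)) dN].
  have exN : exists k, d k < f x by exists N.
  case: (ex_minnP exN) => -[|k] dk min_k.
    by move: dk; rewrite /d expr0 mulr1 ltNge fxL.
  by exists k; rewrite dk leNgt; apply/negP => /min_k; rewrite ltnn.
have [kf kfP] : exists kf : T -> nat,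
    forall x, A x -> d (kf x).+1 < f x <= d (kf x).
  have /choice[kf kfP] : forall x, exists k, A x -> d k.+1 < f x <= d k.
    move=> x; have [/ex_k[k ?]|?] := pselect (A x); last by exists 0%N.
    by exists k.
  by exists kf.
pose s := enum_fset (fset_set X).
have sA x : x \in s -> A x.
  by rewrite /s in_fset_set// inE => /XA.
pose N := (\max_(x <- s) kf x).+1.
(* Keeping all the levels below [f x], not only its own one, bounds each term
   from above and leaves counts of the form required by [count_f]. *)
apply: (@le_trans _ _ (\sum_(x <- s) \sum_(k < N | d k.+1 < f x) d k `^ t)).
  rewrite big_seq [leRHS]big_seq; apply: ler_sum => x xs.
  have /andP[dk kd] := kfP x (sA x xs).
  have kN : (kf x < N)%N by rewrite ltnS leq_bigmax_seq.
  rewrite (bigD1 (Ordinal kN))//=; apply: (@le_trans _ _ (d (kf x) `^ t)).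
    by apply: ge0_ler_powR; rewrite ?nnegrE ?(ltW t0)// ltW// (lt_trans _ dk).
  by rewrite lerDl sumr_ge0// => k _; exact: powR_ge0.
rewrite (exchange_big_dep predT)//=.
apply: (@le_trans _ _ (\sum_(k < N) c * q ^+ k)); last first.
  rewrite -mulr_sumr ler_wpM2l ?sum_geometric_le//.
  have [n _ nB] := count_f L (introT andP (conj L0 (lexx L))).
  rewrite /c mulr_ge0 ?powR_ge0// mulr_ge0 ?powR_ge0//.
  by rewrite -(pmulr_lge0 _ (powR_gt0 (- a) L0)) (le_trans _ nB).
apply: ler_sum => k _; rewrite -term.
have [|n cn nB] := count_f (d k.+1); first by rewrite d_gt0 d_le.
rewrite big_const_seq iter_addr_0 -[leLHS]mulr_natr ler_wpM2l ?powR_ge0//.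
apply: le_trans nB; rewrite ler_nat -size_filter.
set Y := [set x | _] in cn; have Y_fin := card_le_finite cn (finite_II n).
apply: leq_trans (card_fset_set_le cn).
apply: uniq_leq_size; first by rewrite filter_uniq// fset_uniq.
move=> x; rewrite mem_filter => /andP[dx xs].
by rewrite in_fset_set// inE; split => //; exact: sA.
Qed.

(** * Comparison of the two exponents *)

Lemma dirac_zeta_lty (R : realType) (C : metricType R) (s : R) :
  ((dirac_zeta C s < +oo) =
   (\esum_(v in @michon_vertex R C) (diam v `^ s)%:E < +oo))%E.
Proof.
rewrite dirac_zetaE.
have : (0 <= \esum_(v in @michon_vertex R C) (diam v `^ s)%:E)%E.
  by apply: esum_ge0 => v _; rewrite lee_fin powR_ge0.
case: esum => [x x0|_|//]; first by rewrite -EFinM !ltry.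
by rewrite gt0_muley ?lte_fin.
Qed.

(** A real number [a] above the box dimension bounds the covering number by
[delta `^ (- a)] at small scales; as a covering at scale [delta] has at least as
many sets as there are vertices of diameter greater than [delta], the zeta
function is finite at every [t > a]. *)
Lemma abscissa_le_upper_box_dim (R : realType) (C : metricType R) :
  [set: C] !=set0 -> compact [set: C] -> is_ultrametric C ->
  (forall v, @michon_vertex R C v -> 0 < diam v) ->
  (abscissa_of_convergence C <= upper_box_dim C)%E.
Proof.
move=> C0 C_compact C_ultra diam_gt0; rewrite leNgt; apply/negP.
move=> /ereal_inf_lt[y [V V0 <-{y}]].
set f : R -> \bar R := fun=> _ => ltV.
have [eta /= eta0 etaV] := V0.
have V_le delta : 0 < delta < eta -> (f delta <= ereal_sup (f @` V))%E.
  move=> /andP[delta0 delta_eta]; apply: ereal_sup_ubound; exists delta => //.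
  by apply: etaV => //=; rewrite sub0r normrN gtr0_norm.
pose h := Num.min eta 1 / 2.
have m0 : 0 < Num.min eta 1 by rewrite lt_min eta0 ltr01.
have h0 : 0 < h by rewrite divr_gt0.
have hm : h < Num.min eta 1 by rewrite ltr_pdivrMr// ltr_pMr// ltr1n.
move: (hm); rewrite lt_min => /andP[h_eta h1].
have N_gt0 delta : 0 < delta -> 0 < (covering_number C delta)%:R :> R.
  by move=> ?; rewrite ltr0n covering_number_gt0.
have f_ge0 delta : 0 < delta < 1 -> (0 <= f delta)%E.
  move=> delta01; rewrite lee_fin divr_ge0 ?oppr_ge0 ?(ltW (ln_lt0 _))//.
  by rewrite ln_ge0// ler1n -(ltr0n R) N_gt0//; case/andP: delta01.
have [a [a0 aV]] : exists a, 0 <= a /\ ereal_sup (f @` V) = a%:E.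
  have : (0 <= ereal_sup (f @` V))%E.
    by apply: (le_trans (f_ge0 h _)); rewrite ?V_le ?h0.
  move: ltV; case: ereal_sup => [a _ ?|//|//]; first by exists a.
  by rewrite ltNge leey.
move: ltV V_le; rewrite aV => ltV V_le.
have [t at_ tV] : exists2 t, a < t & (t%:E < abscissa_of_convergence C)%E.
  move: ltV; case: abscissa_of_convergence => [b| |//].
  - rewrite lte_fin => ab; exists ((a + b) / 2); rewrite ?lte_fin; lra.
  - by move=> _; exists (a + 1); rewrite ?ltry ?ltrDl.
suff : (dirac_zeta C t < +oo)%E.
  move=> t_fin; move: tV; rewrite ltNge => /negP; apply.
  by apply: ereal_inf_lbound; exists t.
have N_le delta : 0 < delta < Num.min eta 1 ->
    (covering_number C delta)%:R <= delta `^ (- a).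
  rewrite lt_min => /and3P[delta0 delta_eta delta1].
  have : (f delta <= a%:E)%E by rewrite V_le ?delta0.
  have ln_lt : 0 < - ln delta by rewrite oppr_gt0 ln_lt0 ?delta0.
  rewrite lee_fin ler_pdivrMr// mulrN -mulNr -ln_powR.
  by rewrite ler_ln ?posrE ?powR_gt0// N_gt0.
have [K K_le] := mdist_bounded C_compact C_ultra.
pose L := Num.max K 1.
have L1 : 1 <= L by rewrite le_max lexx orbT.
have L0 : 0 < L by exact: lt_le_trans L1.
rewrite dirac_zeta_lty.
(* The bound on the covering number is known only below [Num.min eta 1].  The
   constant also covers the scales [delta] between this number and [L]: there
   the vertices are counted at the smaller scale [h], and [delta <= L]. *)
apply: (@esum_powR_lty _ _ _ (@diam R C) L (1 + h `^ (- a) * L `^ a) a t) => //.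
- move=> v vv; rewrite diam_gt0//= diam_le//; first exact: ltW.
  by move=> x y _ _; rewrite le_max K_le.
- move=> delta /andP[delta0 deltaL].
  have count e : 0 < e -> ([set v | @michon_vertex R C v /\ (e < diam v)%R]
      #<= `I_(covering_number C e))%card.
    move=> e0; apply: card_michon_vertex_le => //.
    by have [] := covering_numberP C_compact C_ultra e0.
  have [delta_m|m_delta] := ltP delta (Num.min eta 1).
    exists (covering_number C delta); first exact: count.
    apply: (le_trans (N_le _ _)); first by rewrite delta0.
    by rewrite ler_peMl ?powR_ge0// lerDl mulr_ge0// powR_ge0.
  exists (covering_number C h).
    apply: card_le_trans (count h h0); apply: subset_card_le => v [vv dv].
    by split => //; apply: lt_trans dv; exact: lt_le_trans m_delta.
  apply: (le_trans (N_le _ _)); first by rewrite h0.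
  rewrite mulrDl mul1r; apply: ler_wpDl; first exact: powR_ge0.
  rewrite -mulrA ler_peMr ?powR_ge0// powRN ler_pdivlMr ?powR_gt0// mul1r.
  by apply: ge0_ler_powR; rewrite ?nnegrE// ltW.
Qed.

Section upper_bound.
Context {R : realType} {C : metricType R}.
Context (C_neq0 : [set: C] !=set0).
Context (C_compact : compact [set: C]).
Context (C_ultra : is_ultrametric C).
Context (lambda : nat -> R).
Context (lambda_decr : forall m n : nat, (m < n)%N -> lambda n < lambda m).
Context (lambda_range : range lambda = [set diam v | v in @michon_vertex R C]).

Let lambda_gt0 n : 0 < lambda n.
Proof. exact: (lambda_gt0 lambda_decr lambda_range). Qed.

(** The diameters [lambda n] tend to 0, so for [s < 0] the single terms
[lambda n `^ s] of the sum are unbounded. *)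
Lemma summable_exponent_ge0 (s Z : R) :
  (\esum_(v in @michon_vertex R C) (diam v `^ s)%:E <= Z%:E)%E -> 0 <= s.
Proof.
move=> leZ; rewrite leNgt; apply/negP => s_lt0.
have le_Z n : lambda n `^ s <= Z.
  have [v vv <-] : [set diam v | v in @michon_vertex R C] (lambda n).
    by rewrite -lambda_range; exists n.
  rewrite -lee_fin; apply: le_trans leZ; apply: esum_ge.
  exists [set v]; first by split => // _ ->.
  by rewrite fsbig_set1.
have Z_gt0 : 0 < Z by apply: lt_le_trans (le_Z 0%N); exact: powR_gt0.
have [n] := ex_lambda_le C_ultra lambda_range C_neq0
  (expR_gt0 (ln Z / s - 1)).
rewrite -ler_ln ?posrE ?expR_gt0// expRK => lt_n.
have : ln (lambda n `^ s) <= ln Z by rewrite ler_ln ?posrE ?powR_gt0// le_Z.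
apply/negP; rewrite -ltNge ln_powR.
suff : s * (ln Z / s - 1) <= s * ln (lambda n).
  apply: lt_le_trans; rewrite mulrBr mulrCA divff ?lt_eqF// mulr1 ltrBrDr.
  by lra.
by rewrite ler_nM2l.
Qed.

(** Chebyshev's inequality for the counting measure on vertices; it needs
[s >= 0], so that [diam v `^ s] increases with the diameter. *)
Lemma card_michon_vertex_powR_le (s Z : R) n :
  (\esum_(v in @michon_vertex R C) (diam v `^ s)%:E <= Z%:E)%E ->
  #|` fset_set [set v | @michon_vertex R C v /\ lambda n <= diam v]|%:R
    * lambda n `^ s <= Z.
Proof.
move=> leZ; have s_ge0 := summable_exponent_ge0 leZ; set W := [set v | _].
have W_fin : finite_set W by exact: finite_michon_vertex_ge.
rewrite -lee_fin; apply: le_trans leZ; apply: esum_ge.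
exists W; first by split => // v [].
rewrite fsbig_finite//= sumEFin lee_fin card_fset_sum1 natr_sum mulr_suml.
rewrite big_seq [leRHS]big_seq; apply: ler_sum => v.
rewrite in_fset_set// inE => -[_ nv]; rewrite mul1r.
by apply: ge0_ler_powR; rewrite ?nnegrE ?diam_ge0// ltW.
Qed.

Lemma ln_covering_number_le (s Z : R) n m delta : (0 < m)%N ->
  (forall v, @michon_vertex R C v -> lambda n <= diam v ->
    (michon_children v #<= `I_m)%card) ->
  (\esum_(v in @michon_vertex R C) (diam v `^ s)%:E <= Z%:E)%E ->
  lambda n.+1 <= delta ->
  ln (covering_number C delta)%:R <= ln Z - s * ln (lambda n) + ln m%:R.
Proof.
move=> m_gt0 children_m leZ n_delta.
have delta_gt0 : 0 < delta by exact: lt_le_trans n_delta.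
set w := #|` fset_set [set v | @michon_vertex R C v /\ lambda n <= diam v]|.
have N_le : (covering_number C delta <= w * m)%N.
  have [_] := covering_numberP C_compact C_ultra delta_gt0; apply.
  have [F [F_diam F_cov]] := covered_by_children C_compact C_ultra
    lambda_decr lambda_range children_m.
  by exists F; split => // i; exact: le_trans (F_diam i) n_delta.
have N_gt0 : (0 < covering_number C delta)%N by exact: covering_number_gt0.
have w_gt0 : (0 < w)%N.
  by move: (leq_trans N_gt0 N_le); rewrite muln_gt0 => /andP[].
have wZ : w%:R * lambda n `^ s <= Z by exact: card_michon_vertex_powR_le.
have Z_gt0 : 0 < Z.
  by apply: lt_le_trans wZ; rewrite mulr_gt0 ?powR_gt0// ltr0n.
apply: (@le_trans _ _ (ln (w * m)%:R)).
  by rewrite ler_ln ?posrE ?ltr0n ?muln_gt0 ?w_gt0// ler_nat.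
have : ln (w%:R * lambda n `^ s) <= ln Z.
  by rewrite ler_ln ?posrE// mulr_gt0 ?powR_gt0 ?ltr0n.
rewrite natrM !lnM ?posrE ?powR_gt0 ?ltr0n// ln_powR; lra.
Qed.

Lemma upper_box_dim_le_abscissa (M : nat -> nat) :
  (forall n, (0 < M n)%N) ->
  (forall (n : nat) (v : set C), michon_vertex v ->
    lambda n <= diam v -> (michon_children v #<= `I_(M n))%card) ->
  (fun n => ln (M n)%:R / - ln (lambda n)) @ \oo --> (0 : R) ->
  (upper_box_dim C <= abscissa_of_convergence C)%E.
Proof.
move=> M_gt0 M_children M_growth.
apply: le_ereal_inf_tmp => _ [s /= s_fin <-].
have [Z leZ] : exists Z,
    (\esum_(v in @michon_vertex R C) (diam v `^ s)%:E <= Z%:E)%E.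
  move: s_fin; rewrite dirac_zeta_lty.
  by case: esum => [Z _|//|_]; [exists Z|exists 0; rewrite leNye].
have s_ge0 := summable_exponent_ge0 leZ.
apply/lee_addgt0Pr => e e_gt0.
have e2 : 0 < e / 2 by rewrite divr_gt0.
have [n0 _ M_small] : \forall n \near \oo,
    ln (M n)%:R / - ln (lambda n) < e / 2.
  exact: cvgr_lt M_growth _ e2.
have [n1 n1_lt1] : exists n, lambda n < 1.
  have := ex_lambda_le C_ultra lambda_range C_neq0 (r := 2^-1).
  rewrite invr_gt0 ltr0n => /(_ isT)[k k_le]; exists k.
  by rewrite (le_lt_trans k_le)// invf_lt1// ltr1n.
apply: ge_ereal_inf.
pose V := [set delta |
  ln (covering_number C delta)%:R / - ln delta <= s + e].
exists (ereal_sup ((fun delta =>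
    (ln (covering_number C delta)%:R / - ln delta)%:E) @` V)); last first.
  by apply: ge_ereal_sup => _ [delta /= deltaV <-]; rewrite -EFinD lee_fin.
exists V => //.
near=> delta; rewrite /V/=.
have delta_gt0 : 0 < delta by near: delta; exact: nbhs_right_gt.
(* The first bound on [delta] forces the index [n] below to be large, so that
   [M n] is small compared to [delta `^ (- (e / 2))]; the second one makes the
   constant [Z] equally small. *)
have delta_n0 : delta < lambda (maxn n0 n1).
  by near: delta; exact: nbhs_right_lt.
have delta_Z : delta < expR (- (ln Z / (e / 2))).
  by near: delta; apply: nbhs_right_lt; exact: expR_gt0.
have [n [n0n n_delta delta_n]] : exists n,
    [/\ (maxn n0 n1 <= n)%N, lambda n.+1 <= delta & delta < lambda n].
  have exn := ex_lambda_le C_ultra lambda_range C_neq0 delta_gt0.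
  case: (ex_minnP exn) => -[|n] n_delta min_n.
    have := le_lt_trans n_delta delta_n0.
    by rewrite ltNge (lambda_leE lambda_decr).
  exists n; split => //.
    have := le_lt_trans n_delta delta_n0.
    by rewrite ltNge (lambda_leE lambda_decr) -ltnNge ltnS.
  by rewrite ltNge; apply/negP => /min_n; rewrite ltnn.
move: n0n; rewrite geq_max => /andP[n0n n1n].
have n_lt1 : lambda n < 1.
  by rewrite (le_lt_trans _ n1_lt1)// (lambda_leE lambda_decr).
have ln_n : 0 < - ln (lambda n) by rewrite oppr_gt0 ln_lt0// lambda_gt0.
have ln_delta : - ln (lambda n) <= - ln delta.
  by rewrite lerN2 ler_ln ?posrE// ltW.
have ln_M : ln (M n)%:R <= e / 2 * - ln delta.
  have := M_small n n0n; rewrite ltr_pdivrMr// => /ltW /le_trans; apply.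
  by rewrite ler_wpM2l// ltW.
have ln_Z : ln Z <= e / 2 * - ln delta.
  rewrite mulrC -ler_pdivrMr// lerNr -[leRHS]expRK.
  by rewrite ler_ln ?posrE ?expR_gt0// ltW.
have ln_s : s * - ln (lambda n) <= s * - ln delta by rewrite ler_wpM2l.
rewrite ler_pdivrMr; last exact: lt_le_trans ln_delta.
have := ln_covering_number_le (M_gt0 n) (M_children n) leZ n_delta.
by move: ln_M ln_Z ln_s; lra.
Unshelve. all: by end_near. Qed.

End upper_bound.

Theorem theorem2 (R : realType) (C : metricType R)
    (C_cantor : cantor_set C) (C_ultra : is_ultrametric C)
    (lambda : nat -> R)
    (lambda_decr : forall m n : nat, (m < n)%N -> lambda n < lambda m)
    (lambda_range : range lambda = [set diam v | v in @michon_vertex R C])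
    (M : nat -> nat) (M_gt0 : forall n, (0 < M n)%N)
    (M_children : forall (n : nat) (v : set C), michon_vertex v ->
      lambda n <= diam v -> (michon_children v #<= `I_(M n))%card)
    (M_growth : (fun n => ln (M n)%:R / - ln (lambda n)) @ \oo --> (0 : R)) :
  abscissa_of_convergence C = upper_box_dim C.
Proof.
have [C_neq0 _ C_compact _] := C_cantor.
apply/eqP; rewrite eq_le; apply/andP; split; last first.
  exact: (upper_box_dim_le_abscissa C_neq0 C_compact C_ultra lambda_decr).
apply: abscissa_le_upper_box_dim => // v vv.
have [n ->] := michon_vertex_lambda lambda_range vv.
exact: (lambda_gt0 lambda_decr lambda_range).
Qed.
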